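(* Consider the linear program in standard general form: minimize $c^{T}x$ over $x\in\mathbb{R}^d$ subject to $A^I x=b^I$, $A^J x\ge b^J$, $Ex\ge b_L$, $Fx\ge b_U$ (see context). Then: (i) If the linear program has a feasible solution, then it has a basic feasible solution. (ii) If the linear program has an optimal solution, then it has a basic optimal solution (an optimal solution that is also a basic solution).
   Context: Standard general form LP: $A^I\in\mathbb{R}^{m\times d}$, $A^J\in\mathbb{R}^{n\times d}$, $E\in\mathbb{R}^{d\times d}$ is diagonal with diagonal entries in $\{1,-1\}$, $F=-E$, and $b^I\in\mathbb{R}^m$, $b^J\in\mathbb{R}^n$, $b_L,b_U\in\mathbb{R}^d$. Also $\bar c\in\mathbb{R}^d$ with $\bar c\ge 0$ and $c=E^{T}\bar c$. Inequalities are componentwise. Stack the constraints as $A=(A^I,A^J,E,F)\in\mathbb{R}^{(m+n+2d)\times d}$ and $b=(b^I,b^J,b_L,b_U)$. Standing assumptions: $\operatorname{rank}(A^I)<d$ and $\operatorname{rank}(A)=d$. A point is feasible if it satisfies all constraints. A base $B$ is a set of $d$ row indices such that the corresponding rows of $A$ are linearly independent; $A_B$ and $b_B$ denote the corresponding $d\times d$ submatrix of $A$ and subvector of $b$. A vector $x\in\mathbb{R}^d$ is a basic solution if $A_B x=b_B$ for some base $B$, and a basic feasible solution if it is both basic and feasible. *)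

(* Defs.v *)
From HB Require Import structures.
From mathcomp Require Import all_boot all_order all_algebra.
From mathcomp Require Import reals.

Set Implicit Arguments.
Unset Strict Implicit.
Unset Printing Implicit Defensive.

Import Order.TTheory GRing.Theory Num.Theory.
Local Open Scope ring_scope.

Definition vle (R : realType) (k : nat) (u v : 'cV[R]_k) : Prop :=
  forall i, u i 0 <= v i 0.

(* Raw data only: the sign conditions and the rank assumptions are the
   predicate [standard_general_form] below. *)
Record lp_data (R : realType) (m n d : nat) := LPData {
  lpAI : 'M[R]_(m, d);
  lpAJ : 'M[R]_(n, d);
  lpE : 'M[R]_d;
  lpbI : 'cV[R]_m;
  lpbJ : 'cV[R]_n;
  lpbL : 'cV[R]_d;
  lpbU : 'cV[R]_d;
  lpcbar : 'cV[R]_d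
}.

Section LinearProgram.
Variables (R : realType) (m n d : nat) (P : lp_data R m n d).

Definition lpF : 'M[R]_d := - lpE P.

Definition lpc : 'cV[R]_d := (lpE P)^T *m lpcbar P.

Definition lpA : 'M[R]_(m + n + (d + d), d) :=
  col_mx (col_mx (lpAI P) (lpAJ P)) (col_mx (lpE P) lpF).

Definition lpb : 'cV[R]_(m + n + (d + d)) :=
  col_mx (col_mx (lpbI P) (lpbJ P)) (col_mx (lpbL P) (lpbU P)).

Definition standard_general_form : Prop :=
  [/\ is_diag_mx (lpE P),
      forall i, lpE P i i = 1 \/ lpE P i i = -1,
      vle 0 (lpcbar P),
      (\rank (lpAI P) < d)%N
    & \rank lpA = d].

Definition feasible (x : 'cV[R]_d) : Prop :=
  [/\ lpAI P *m x = lpbI P,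
      vle (lpbJ P) (lpAJ P *m x),
      vle (lpbL P) (lpE P *m x)
    & vle (lpbU P) (lpF *m x)].

Definition objective (x : 'cV[R]_d) : R := (lpc^T *m x) 0 0.

Definition optimal (x : 'cV[R]_d) : Prop :=
  feasible x /\ forall y, feasible y -> objective x <= objective y.

(* Rows are selected in increasing index order; the number of rows is written
   [#|B|], which [is_base] requires to be [d]. *)
Definition base_mx (B : {set 'I_(m + n + (d + d))}) : 'M[R]_(#|B|, d) :=
  rowsub (fun i : 'I_#|B| => enum_val i) lpA.

Definition base_rhs (B : {set 'I_(m + n + (d + d))}) : 'cV[R]_#|B| :=
  rowsub (fun i : 'I_#|B| => enum_val i) lpb.

Definition is_base (B : {set 'I_(m + n + (d + d))}) : Prop :=
  #|B| = d /\ row_free (base_mx B).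

Definition basic_solution (x : 'cV[R]_d) : Prop :=
  exists B, is_base B /\ base_mx B *m x = base_rhs B.

Definition basic_feasible_solution (x : 'cV[R]_d) : Prop :=
  basic_solution x /\ feasible x.

Definition basic_optimal_solution (x : 'cV[R]_d) : Prop :=
  optimal x /\ basic_solution x.

End LinearProgram.

(* Main.v *)
(** Every nonzero direction [v] violates some constraint eventually, because the
    rows of both [E] and [- E] are among the constraints.  If the rows active at
    a feasible [x] do not determine it, some [v != 0] is killed by all of them;
    orient [v] so that the objective does not increase and move along it until
    the first inactive constraint becomes active.  The set of active rows grows
    strictly, so the process ends at a basic feasible point whose objective
    value is at most the initial one. *)
Require Import Defs.
From HB Require Import structures.
From mathcomp Require Import all_boot all_order all_algebra.
From mathcomp Require Import reals.

Set Implicit Arguments.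
Unset Strict Implicit.
Unset Printing Implicit Defensive.

Import Order.TTheory GRing.Theory Num.Theory.
Local Open Scope ring_scope.

Lemma row_full_kerPn (F : fieldType) (p d : nat) (A : 'M[F]_(p, d)) :
  reflect (exists2 v : 'cV_d, v != 0 & A *m v = 0) (~~ row_full A).
Proof.
apply: (iffP idP) => [|[v v0 Av]].
  (* The columns of [cokermx A] are killed by [A], and one of them is nonzero when [A] lacks full
     column rank. *)
  rewrite -cokermx_eq0 => /matrix0Pn[i [j cij]]; exists (col j (cokermx A)).
    by apply/matrix0Pn; exists i, 0; rewrite mxE.
  by rewrite colE mulmxA mulmx_coker mul0mx.
apply: contra v0 => /row_fullP[B BA].
by rewrite -[v]mul1mx -BA -mulmxA Av mulmx0.
Qed.

Lemma rowsub_enum_val_mul_eq0 (F : fieldType) (p d : nat) (A : 'M[F]_(p, d))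
    (S : {set 'I_p}) (v : 'cV[F]_d) :
  rowsub (fun k : 'I_#|S| => enum_val k) A *m v = 0 <->
  {in S, forall i, (A *m v) i 0 = 0}.
Proof.
rewrite mul_rowsub_mx; split=> [Sv i iS|Sv]; last first.
  by apply/colP => k; rewrite !mxE -[RHS](Sv _ (enum_valP k)) mxE.
have /colP/(_ (enum_rank_in iS i)) := Sv.
by rewrite ![in LHS]mxE [RHS]mxE enum_rankK_in // mxE.
Qed.

(** Extracts a base from a spanning family of rows: [fullrankfun] picks [d] independent ones, and
    [B] is the set of their indices. *)
Lemma row_free_subset (F : fieldType) (p d : nat) (A : 'M[F]_(p, d))
    (S : {set 'I_p}) :
  row_full (rowsub (fun k : 'I_#|S| => enum_val k) A) ->
  exists B : {set 'I_p},
    [/\ B \subset S, #|B| = d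
      & row_free (rowsub (fun k : 'I_#|B| => enum_val k) A)].
Proof.
move=> fullS; pose f k := enum_val (fullrankfun fullS k).
have free_f : row_free (rowsub f A).
  by have := fullrowsub_free fullS; rewrite -rowsub_comp.
pose B := [set f k | k : 'I_d]; have cardB : #|B| = d.
  rewrite card_imset ?card_ord //.
  by apply: inj_comp enum_val_inj _; apply: fullrankfun_inj.
exists B; split => //.
  by apply/subsetP => _ /imsetP[k _ ->]; apply: enum_valP.
(* The enumeration of [B] may order the rows differently from [f], so freeness is transferred by
   rank: the row space of [rowsub f A], of dimension [d], lies in that of the rows in [B]. *)
rewrite /row_free eqn_leq rank_leq_row {1}cardB /=.
rewrite -{1}(eqP free_f); apply/mxrankS/row_subP => k.
have fkB : f k \in B by apply: imset_f.
rewrite row_rowsub -(enum_rankK_in fkB fkB).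
by rewrite -(row_rowsub (fun i : 'I_#|B| => enum_val i)) row_sub.
Qed.

Section Polyhedron.
Variables (R : realFieldType) (p d : nat) (A : 'M[R]_(p, d)) (b : 'cV[R]_p).

Definition active (x : 'cV[R]_d) : {set 'I_p} := [set i | (A *m x) i 0 == b i 0].

Lemma active_step (x v : 'cV[R]_d) :
  (forall i, b i 0 <= (A *m x) i 0) ->
  {in active x, forall i, (A *m v) i 0 = 0} ->
  (exists i, (A *m v) i 0 < 0) ->
  exists t : R, [/\ 0 <= t, forall i, b i 0 <= (A *m (x + t *: v)) i 0
                  & active x \proper active (x + t *: v)].
Proof.
move=> xP Av [i0 Avi0].
(* Ratio test: when [(A *m v) i 0 < 0], [r i] is the step length at which row [i] becomes active.
   The smallest such ratio keeps every constraint satisfied. *)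
pose r i := ((A *m x) i 0 - b i 0) / - (A *m v) i 0.
have step t i : (A *m (x + t *: v)) i 0 = (A *m x) i 0 + t * (A *m v) i 0.
  by rewrite mulmxDr -scalemxAr !mxE.
case: (@arg_minP _ _ _ i0 (fun i => (A *m v) i 0 < 0) r Avi0) => j Avj minj.
have rj_ge0 : 0 <= r j by rewrite divr_ge0 ?subr_ge0 // oppr_ge0 ltW.
exists (r j); split => // [i|].
  rewrite step; have [Avi|Avi] := ltP ((A *m v) i 0) 0.
    have := minj i Avi; rewrite {2}/r ler_pdivlMr ?oppr_gt0 //.
    by rewrite mulrN lerBrDl lerBlDr.
  by rewrite (le_trans (xP i)) // lerDl mulr_ge0.
apply/properP; split.
  by apply/subsetP => i ix; rewrite inE step Av // mulr0 addr0; rewrite inE in ix.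
(* The minimising row [j] is new: [v] strictly decreases it, whereas [v] kills every row active at
   [x]. *)
exists j; last by apply/negP => /Av Avj0; rewrite Avj0 ltxx in Avj.
rewrite inE step /r invrN mulrN mulNr divfK ?(lt_eqF Avj) //.
by rewrite subKr.
Qed.

(** Induction on the number of inactive rows. The first hypothesis says that the recession cone is
    trivial, so every nonzero direction decreases some row. The inclusion of active sets is kept so
    that equality constraints survive the descent. *)
Lemma exists_vertex_le (g : 'rV[R]_d) (x : 'cV[R]_d) :
  (forall v : 'cV[R]_d, (forall i, 0 <= (A *m v) i 0) -> v = 0) ->
  (forall i, b i 0 <= (A *m x) i 0) ->
  exists y : 'cV[R]_d,
    [/\ forall i, b i 0 <= (A *m y) i 0, active x \subset active y,
        (g *m y) 0 0 <= (g *m x) 0 0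
      & row_full (rowsub (fun k : 'I_#|active y| => enum_val k) A)].
Proof.
move=> recA; have [k] := ubnP #|~: active x|; elim: k x => // k IHk x ltk xP.
have [fullx|/row_full_kerPn[w w0 /rowsub_enum_val_mul_eq0 Aw]] :=
  boolP (row_full (rowsub (fun k : 'I_#|active x| => enum_val k) A)).
  by exists x.
have [v [Av v0 gv]] : exists v : 'cV[R]_d,
    [/\ {in active x, forall i, (A *m v) i 0 = 0}, v != 0 & (g *m v) 0 0 <= 0].
  have [gw|gw] := leP ((g *m w) 0 0) 0; first by exists w.
  exists (- w); split; rewrite ?oppr_eq0 //.
    by move=> l lx; rewrite mulmxN mxE Aw ?oppr0.
  by rewrite mulmxN mxE oppr_le0 ltW.
have /existsP Avneg : [exists i, (A *m v) i 0 < 0].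
  apply: contraNT v0; rewrite negb_exists => /forallP Avge0.
  by apply/eqP/recA => i; rewrite leNgt.
have [t [t0 yP ltxy]] := active_step xP Av Avneg.
have [|z [zP yz gz fullz]] := IHk _ _ yP.
  rewrite (leq_trans _ (_ : #|~: active x| <= k)%N) //.
  by rewrite proper_card // properC.
exists z; split => //; first exact: subset_trans (proper_sub ltxy) yz.
apply: le_trans gz _.
by rewrite mulmxDr -scalemxAr [leLHS]mxE gerDl [leLHS]mxE mulr_ge0_le0.
Qed.

End Polyhedron.

Section LinearProgram.
Variables (R : realType) (m n d : nat) (P : lp_data R m n d).

(** Equalities are recast as inequalities whose rows are active, a form preserved when the active
    set grows. *)
Lemma feasibleP (x : 'cV[R]_d) :
  feasible P x <->
  (forall i, lpb P i 0 <= (lpA P *m x) i 0) /\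
  forall i : 'I_m, lshift (d + d) (lshift n i) \in active (lpA P) (lpb P) x.
Proof.
rewrite /lpA /lpb !mul_col_mx; split => [[xI xJ xL xU]|[xge xeq]].
  split=> [i|i]; last by rewrite inE !mul_col_mx !col_mxEu xI.
  rewrite -(splitK i); case: split => j /=.
    rewrite !col_mxEu -(splitK j); case: split => l /=.
      by rewrite !col_mxEu xI.
    by rewrite !col_mxEd.
  rewrite !col_mxEd -(splitK j); case: split => l /=.
    by rewrite !col_mxEu.
  by rewrite !col_mxEd.
split => [|i|i|i].
- apply/colP => i; have := xeq i.
  by rewrite inE !mul_col_mx !col_mxEu => /eqP.
- by have := xge (lshift _ (rshift m i)); rewrite !(col_mxEu, col_mxEd).
- by have := xge (rshift _ (lshift d i)); rewrite !(col_mxEu, col_mxEd).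
- by have := xge (rshift _ (rshift d i)); rewrite !(col_mxEu, col_mxEd).
Qed.

(** The blocks [E] and [- E] together force [E v = 0], and a diagonal matrix with entries [1] or
    [-1] is injective. *)
Lemma lpA_recession_eq0 (v : 'cV[R]_d) :
  standard_general_form P -> (forall i, 0 <= (lpA P *m v) i 0) -> v = 0.
Proof.
move=> [diagE E1 _ _ _]; rewrite /lpA !mul_col_mx => Av; apply/colP => i.
have Ev0 : (lpE P *m v) i 0 = 0.
  have := Av (rshift _ (lshift d i)); have := Av (rshift _ (rshift d i)).
  rewrite !(col_mxEu, col_mxEd) mulNmx mxE oppr_ge0 => Ev_le0 Ev_ge0.
  by apply/le_anti; rewrite Ev_le0.
have : lpE P i i * v i 0 = 0.
  rewrite -Ev0 mxE (bigD1 i) //= big1 ?addr0 // => j ji.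
  by rewrite (is_diag_mxP diagE) ?mul0r // eq_sym.
rewrite mxE; case: (E1 i) => ->; rewrite ?mul1r ?mulN1r //.
by move/eqP; rewrite oppr_eq0 => /eqP.
Qed.

Lemma exists_basic_feasible_le (x : 'cV[R]_d) :
  standard_general_form P -> feasible P x ->
  exists2 y, basic_feasible_solution P y & objective P y <= objective P x.
Proof.
move=> hP /feasibleP[xge xeq].
have recA v := @lpA_recession_eq0 v hP.
have [y [yge xy yle fully]] := exists_vertex_le (lpc P)^T recA xge.
exists y => //; split; last first.
  by apply/feasibleP; split => // i; apply: (subsetP xy).
have [B [By cardB freeB]] := row_free_subset fully.
exists B; split; first by split.
(* Every row of [B] is active at [y], which is the base equation read row by row. *)
rewrite /base_mx /base_rhs mul_rowsub_mx; apply/colP => i.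
have /(subsetP By) : enum_val i \in B by apply: enum_valP.
by rewrite inE !mxE => /eqP.
Qed.

End LinearProgram.

Theorem theorem3p4 (R : realType) (m n d : nat) (P : lp_data R m n d)
    (hP : standard_general_form P) :
  ((exists x : 'cV[R]_d, feasible P x) ->
     exists x : 'cV[R]_d, basic_feasible_solution P x) /\
  ((exists x : 'cV[R]_d, optimal P x) ->
     exists x : 'cV[R]_d, basic_optimal_solution P x).
Proof.
split=> [[x xP]|[x [xP xopt]]]; have [y yP yx] := exists_basic_feasible_le hP xP.
  by exists y.
case: yP => ybasic yP; exists y; split => //; split => // z zP.
exact: le_trans yx (xopt z zP).
Qed.
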